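(* Let $L=L_1\cup\dots\cup L_n$ be a pencil of lines through a point $O$ in $\mathbb{R}^2$. Then every colouring of $\mathbb{R}^2$ that uses finitely many but at least two colours contains a smiling congruent copy of $L$.
   Context: A pencil through $O$ is a union $L=L_1\cup\dots\cup L_n$ of finitely many lines in the plane all passing through the common point $O$. A congruent copy of $L$ is its image under an isometry $g$ of the plane (a pencil through $g(O)$). For a given colouring, a pencil $L_1\cup\dots\cup L_n$ through $O$ is smiling if there is a colour $c$ such that every line $L_i$ contains a point of colour $c$ but $O$ does not have colour $c$. *)

(* Defs.v *)
From HB Require Import structures.
From mathcomp Require Import all_boot all_order all_algebra.
From mathcomp Require Import all_classical all_reals.

Set Implicit Arguments.
Unset Strict Implicit.
Unset Printing Implicit Defensive.

Import Order.TTheory GRing.Theory Num.Theory.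
Local Open Scope classical_set_scope.
Local Open Scope ring_scope.

Notation plane R := 'rV[R]_2.

(* The norm that MathComp-Analysis puts on row vectors is the sup norm, so the
   Euclidean distance is written out. *)
Definition edist (R : realType) (p q : plane R) : R :=
  Num.sqrt (\sum_(j < 2) (p 0 j - q 0 j) ^+ 2).

Definition isometry (R : realType) (g : plane R -> plane R) : Prop :=
  forall p q, edist (g p) (g q) = edist p q.

Definition is_line (R : realType) (l : set (plane R)) : Prop :=
  exists p v : plane R, v != 0 /\ l = [set p + t *: v | t in [set: R]].

(* A pencil is kept as the family of its lines together with its centre: for
   n = 1 the union of the lines does not determine the centre. *)
Definition is_pencil (R : realType) (n : nat) (O : plane R)
    (L : 'I_n -> set (plane R)) : Prop :=
  forall i, is_line (L i) /\ L i O.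

Definition smiling (R : realType) (C : Type) (f : plane R -> C) (n : nat)
    (O : plane R) (L : 'I_n -> set (plane R)) : Prop :=
  exists c : C, (forall i, exists2 p, L i p & f p = c) /\ f O <> c.

Definition congruent_copy (R : realType) (n : nat)
    (O : plane R) (L : 'I_n -> set (plane R))
    (O' : plane R) (L' : 'I_n -> set (plane R)) : Prop :=
  exists2 g : plane R -> plane R, isometry g &
    O' = g O /\ forall i, L' i = g @` L i.

(* Main.v *)
(** Suppose that no copy of the pencil smiles: whenever every line of a copy
    centred at P contains a point of colour c, the point P has colour c.  Let
    v_1, ..., v_n be unit complex numbers directing the lines.  Gallai's theorem
    gives q and m > 0 such that the points q + m v_i^2 share a colour c.  By the
    inscribed angle theorem every point of the circle of centre q and radius m
    sees these points along the lines of a copy of the pencil, so the whole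
    circle has colour c.  If e > 0 is small, then every P at squared distance at
    most (1 + e) m^2 from q is the centre of a copy all of whose lines meet the
    circle: rotate the pencil so that none of its lines is perpendicular to the
    line Pq.  Iterating, c spreads to the whole plane. *)
Require Import Defs.
From mathcomp Require Import all_boot all_order all_algebra.
From mathcomp Require Import all_classical all_reals.
From mathcomp Require Import ring lra.

Set Implicit Arguments.
Unset Strict Implicit.
Unset Printing Implicit Defensive.

Import Order.TTheory GRing.Theory Num.Theory.
Local Open Scope classical_set_scope.
Local Open Scope ring_scope.

(** * Gallai's theorem in an abelian group, by colour focusing *)

Section Gallai.
Variable V : zmodType.
Implicit Types (Z P : seq V) (Q : seq (V * nat)).

Definition constant_on (K : Type) (f : V -> K) Z (h : V * nat) : Prop :=
  (0 < h.2)%N /\ {in Z &, forall z z', f (h.1 + z *+ h.2) = f (h.1 + z' *+ h.2)}.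

(* The finite list Q of candidates makes the theorem usable on the product
   colouring of [gallai_focus], whose colour set must be finite. *)
Definition gallai_bounded (K : finType) Z : Prop :=
  exists Q, forall f : V -> K, exists2 h, h \in Q & constant_on f Z h.

(* Homothetic copies of Z of pairwise distinct colours s, such that adding the
   image of z0 to any of them adds the same point p. *)
Definition focused (K : finType) (f : V -> K) (z0 : V) Z Q (p : V) (s : seq K) :=
  uniq s /\ {in s, forall c, exists h, [/\ h \in Q, (0 < h.2)%N,
    h.1 + z0 *+ h.2 = p & {in Z, forall z, f (h.1 + z *+ h.2) = c}]}.

(** Induction on [r]. A copy [a] of [Z] is taken monochromatic for the colouring of [x] by the
    pattern of [f] on [x + Y], so the shifts by [a.1 + z *+ a.2] with [z] in [Z] look alike on [Y].
    The colour of the shifted focus [p] either lies in [s], which completes a copy of [z0 :: Z], or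
    is a further colour. *)
Lemma gallai_focus (K : finType) (z0 : V) Z (r : nat) :
  (forall K' : finType, gallai_bounded K' Z) ->
  exists Q P, forall f : V -> K,
    (exists2 h, h \in Q & constant_on f (z0 :: Z) h) \/
    (exists p s, [/\ p \in P, size s = r & focused f z0 Z Q p s]).
Proof.
move=> gZ; elim: r => [|r [Q [P QP]]].
  by exists [::], [:: 0] => f; right; exists 0, [::]; rewrite mem_seq1.
pose Y := P ++ [seq h.1 + z *+ h.2 | h <- Q, z <- Z].
have [Q' gQ'] := gZ {ffun 'I_(size Y) -> K}.
pose z1 := head 0 Z.
exists ([seq (a.1 + z1 *+ a.2 + h.1, h.2) | a <- Q', h <- Q] ++
        [seq (a.1 + h.1, (a.2 + h.2)%N) | a <- Q', h <- Q] ++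
        [seq (a.1 + p, a.2) | a <- Q', p <- P]),
  [seq a.1 + z0 *+ a.2 + p | a <- Q', p <- P] => f.
have [a aQ' [a_gt0 fa]] :=
  gQ' (fun x => [ffun i : 'I_(size Y) => f (x + nth 0 Y i)]).
have {}fa z y : z \in Z -> y \in Y ->
    f (a.1 + z *+ a.2 + y) = f (a.1 + z1 *+ a.2 + y).
  move=> zZ yY; have z1Z : z1 \in Z.
    by rewrite /z1; case: (Z) zZ => //= x Z' _; exact: mem_head.
  have iY : (index y Y < size Y)%N by rewrite index_mem.
  by have /ffunP/(_ (Ordinal iY)) := fa _ _ zZ z1Z; rewrite !ffunE /= nth_index.
have [[h hQ [h_gt0 fh]]|[p [s [pP <- [s_uniq sP]]]]] :=
  QP (fun y => f (a.1 + z1 *+ a.2 + y)).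
  left; exists (a.1 + z1 *+ a.2 + h.1, h.2).
    by rewrite mem_cat (allpairs_f (fun a h => (_, _))).
  by split=> // z z' zZ z'Z /=; rewrite -!(addrA _ h.1); exact: fh.
have pY : p \in Y by rewrite mem_cat pP.
have [cs|cs] := boolP (f (a.1 + z1 *+ a.2 + p) \in s).
  left; have [h [hQ h_gt0 hp fh]] := sP _ cs.
  exists (a.1 + z1 *+ a.2 + h.1, h.2).
    by rewrite mem_cat (allpairs_f (fun a h => (_, _))).
  split=> // z z' /=; rewrite !inE -!(addrA _ h.1).
  have E x : (x == z0) || (x \in Z) ->
      f (a.1 + z1 *+ a.2 + (h.1 + x *+ h.2)) = f (a.1 + z1 *+ a.2 + p).
    by case/orP => [/eqP->|/fh//]; rewrite hp.
  by move=> /E-> /E->.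
right; exists (a.1 + z0 *+ a.2 + p), (f (a.1 + z1 *+ a.2 + p) :: s); split=> //.
  exact: (allpairs_f (fun a p => _)).
split; first by rewrite /= cs.
move=> c; rewrite inE => /orP[/eqP->|{}/sP [h [hQ h_gt0 hp fh]]].
  exists (a.1 + p, a.2); split=> //=.
  - by rewrite !mem_cat (allpairs_f (fun a p => (_, _)) aQ' pP) !orbT.
  - by rewrite addrAC.
  - by move=> z zZ; rewrite addrAC fa.
(* Widening [h] by [a] keeps the colour over [Z] and sends [z0] to the new focus. *)
exists (a.1 + h.1, (a.2 + h.2)%N); split=> /=.
- by rewrite !mem_cat (allpairs_f (fun a h => (_, _)) aQ' hQ) !orbT.
- by rewrite addn_gt0 a_gt0.
- by rewrite mulrnDr -hp addrACA.
- move=> z zZ; rewrite mulrnDr addrACA fa ?fh//.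
  by rewrite mem_cat (allpairs_f (fun h z => _) hQ zZ) orbT.
Qed.

Lemma gallai_finite Z (K : finType) : gallai_bounded K Z.
Proof.
elim: Z K => [|z0 Z IHZ] K.
  by exists [:: (0, 1%N)] => f; exists (0, 1%N); rewrite ?mem_head.
(* One colour more than [K] has: the focused alternative is impossible. *)
have [Q [P QP]] := gallai_focus K z0 #|K|.+1 IHZ.
exists Q => f; have [//|[p [s [_ ss [us _]]]]] := QP f.
by have := max_card [in s]; rewrite (card_uniqP us) ss ltnn.
Qed.

Lemma gallai Z (K : finType) (f : V -> K) : exists q m,
  (0 < m)%N /\ {in Z &, forall z z', f (q + z *+ m) = f (q + z' *+ m)}.
Proof. by have [Q /(_ f) [[q m] _ ?]] := gallai_finite Z K; exists q, m. Qed.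

End Gallai.

(** * Circles in a colouring without smiling copies *)

(** A square root of a unit complex number; it lets points of a circle be written as [w^2]. *)
Lemma half_angle (R : rcfType) (x y : R) : x ^+ 2 + y ^+ 2 = 1 ->
  exists a b : R, [/\ a ^+ 2 + b ^+ 2 = 1, a ^+ 2 - b ^+ 2 = x & 2 * (a * b) = y].
Proof.
move=> xy1; have [x_ge x_le] : -1 <= x /\ x <= 1 by split; nra.
have y2 : y ^+ 2 = (1 + x) * (1 - x) by lra.
set a := Num.sqrt ((1 + x) / 2); set b := Num.sqrt ((1 - x) / 2).
have a2 : a ^+ 2 = (1 + x) / 2 by rewrite sqr_sqrtr//; lra.
have b2 : b ^+ 2 = (1 - x) / 2 by rewrite sqr_sqrtr//; lra.
have a0 : 0 <= a by exact: sqrtr_ge0.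
have b0 : 0 <= b by exact: sqrtr_ge0.
have ab2 : (2 * (a * b)) ^+ 2 = y ^+ 2 by rewrite !exprMn a2 b2 y2; field.
have /eqP := ab2; rewrite eqf_sqr => /orP[/eqP ab|/eqP ab].
  by exists a, b; split=> //; rewrite a2 b2; field.
exists a, (- b); split; rewrite ?sqrrN ?a2 ?b2; [by field..|].
by rewrite mulrN mulrN ab opprK.
Qed.

(* The coordinates of a colouring of the plane without smiling copies of the
   pencil directed by the unit vectors (A i, B i). *)
Section SmileFree.
Variables (R : realType) (n : nat) (A B : 'I_n -> R).
Hypothesis AB1 : forall i, A i ^+ 2 + B i ^+ 2 = 1.
Variables (C : Type) (f : R -> R -> C).
Hypothesis smile_free : forall x y a b c, a ^+ 2 + b ^+ 2 = 1 ->
  (forall i, exists t,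
     f (x + t * (a * A i - b * B i)) (y + t * (a * B i + b * A i)) = c) ->
  f x y = c.

(* The chord from w^2 to v^2 has direction i v w, so w^2 sees the points v_i^2
   along the pencil rotated by i w. *)
Lemma circle_monochromatic (x0 y0 r : R) (c : C) : 0 < r ->
  (forall i, f (x0 + r * (A i ^+ 2 - B i ^+ 2)) (y0 + r * (2 * (A i * B i))) = c) ->
  forall x y, (x - x0) ^+ 2 + (y - y0) ^+ 2 = r ^+ 2 -> f x y = c.
Proof.
move=> r_gt0 fc x y xyr; have r_neq0 : r != 0 by rewrite gt_eqF.
have [|a [b [ab1 xE yE]]] := @half_angle R ((x - x0) / r) ((y - y0) / r).
  by rewrite !expr_div_n -mulrDl xyr divff// sqrf_eq0.
apply: (smile_free (a := - b) (b := a)); first by rewrite sqrrN addrC.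
(* Signed length of the chord from [w^2] to [v_i^2]: [2 r] times the sine of the angle from [w] to
   [v_i]. *)
move=> i; exists (2 * r * (B i * a - A i * b)); rewrite -(fc i).
have -> : x = x0 + r * (a ^+ 2 - b ^+ 2) by rewrite xE; field.
have -> : y = y0 + r * (2 * (a * b)) by rewrite yE; field.
have A2 : A i ^+ 2 = 1 - B i ^+ 2 by rewrite -(AB1 i) addrK.
have a2 : a ^+ 2 = 1 - b ^+ 2 by rewrite -ab1 addrK.
by congr f; ring: A2 a2.
Qed.

(** The square is that of the cosine between a rotated line and the x-axis. Rotating by the
    direction of [1 + i k] makes no line vertical once [k] exceeds every [|A i / B i|]. *)
Lemma rotation_off_axis : exists a b e : R, [/\ a ^+ 2 + b ^+ 2 = 1, 0 < e &
  forall i, e <= (a * A i - b * B i) ^+ 2].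
Proof.
pose k := 1 + \sum_i `|A i / B i|.
have k_neq i : A i - k * B i != 0.
  apply/eqP => /subr0_eq Ak; have [B0|B0] := eqVneq (B i) 0.
    by have := AB1 i; rewrite Ak B0; lra.
  have k_ge0 : 0 <= k by rewrite addr_ge0// sumr_ge0.
  have kE : k = `|A i / B i| by rewrite Ak mulfK// ger0_norm.
  have : `|A i / B i| < k.
    rewrite /k (bigD1 i)//=.
    have : 0 <= \sum_(j < n | j != i) `|A j / B j| by exact: sumr_ge0.
    lra.
  by rewrite -kE ltxx.
have N_gt0 : 0 < 1 + k ^+ 2 by rewrite ltr_wpDr// sqr_ge0.
pose N := Num.sqrt (1 + k ^+ 2).
have N2 : N ^+ 2 = 1 + k ^+ 2 by rewrite sqr_sqrtr// ltW.
have N0 : N != 0 by rewrite gt_eqF// sqrtr_gt0.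
exists N^-1, (k / N), (\big[Num.min/1]_i (N^-1 * A i - k / N * B i) ^+ 2).
split=> [||i]; last exact: bigmin_le.
  by rewrite exprVn expr_div_n -[X in X + _]div1r -mulrDl -N2 divff// sqrf_eq0.
apply: lt_bigmin => // i _; rewrite exprn_even_gt0//=.
by rewrite [k / N]mulrC -mulrA -mulrBr mulf_neq0 ?invr_eq0.
Qed.

(** A line through a point at distance [d] from the centre, at an angle of cosine [w] to the radius,
    meets the circle once [d^2 (1 - w^2) <= s]. This holds as [w^2 >= e] and
    [(1 + e)(1 - e) <= 1]. *)
Lemma circle_growth (a b e : R) : a ^+ 2 + b ^+ 2 = 1 -> 0 < e ->
  (forall i, e <= (a * A i - b * B i) ^+ 2) ->
  forall (x0 y0 s : R) (c : C), 0 <= s ->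
  (forall x y, (x - x0) ^+ 2 + (y - y0) ^+ 2 = s -> f x y = c) ->
  forall x y, (x - x0) ^+ 2 + (y - y0) ^+ 2 <= (1 + e) * s -> f x y = c.
Proof.
move=> ab1 e_gt0 eAB x0 y0 s c s_ge0 fc x y.
set p := x - x0; set q := y - y0 => pqs.
pose d := Num.sqrt (p ^+ 2 + q ^+ 2).
have d2 : d ^+ 2 = p ^+ 2 + q ^+ 2 by rewrite sqr_sqrtr// addr_ge0// sqr_ge0.
have [u [v [uv1 pE qE]]] : exists u v,
    [/\ u ^+ 2 + v ^+ 2 = 1, p = d * u & q = d * v].
  have [d0|d0] := eqVneq d 0.
    exists 1, 0; have : p ^+ 2 + q ^+ 2 = 0 by rewrite -d2 d0 expr0n.
    move/eqP; rewrite paddr_eq0 ?sqr_ge0// !sqrf_eq0 => /andP[/eqP-> /eqP->].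
    by rewrite d0 !mul0r expr1n expr0n addr0.
  exists (p / d), (q / d); rewrite !expr_div_n -mulrDl -d2 divff ?sqrf_eq0//.
  by split=> //; field.
apply: (smile_free (a := u * a - v * b) (b := u * b + v * a)).
  by rewrite -[RHS]mulr1 -{1}uv1 -ab1; ring.
move=> i; set X := _ - _; set Y := _ + _.
set w := a * A i - b * B i.
have w2 : w ^+ 2 + (a * B i + b * A i) ^+ 2 = 1.
  by rewrite -[RHS]mulr1 -{1}ab1 -(AB1 i) /w; ring.
have XY1 : X ^+ 2 + Y ^+ 2 = 1.
  by rewrite -[RHS]mulr1 -{1}uv1 -w2 /X /Y /w; ring.
have pX : p * X + q * Y = d * w.
  by rewrite pE qE -[d in RHS]mulr1 -uv1 /X /Y /w; ring.
have D_ge0 : 0 <= d ^+ 2 * w ^+ 2 - d ^+ 2 + s.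
  have we := eAB i; have w1 : 0 <= 1 - w ^+ 2 by rewrite -w2 addrAC subrr add0r sqr_ge0.
  have : d ^+ 2 * (1 - w ^+ 2) <= (1 + e) * s * (1 - w ^+ 2).
    by rewrite ler_wpM2r// d2.
  have : (1 + e) * s * (1 - w ^+ 2) <= (1 + e) * s * (1 - e).
    by rewrite ler_wpM2l ?mulr_ge0 ?lerB// addr_ge0// ltW.
  have : 0 <= s * e ^+ 2 by rewrite mulr_ge0// sqr_ge0.
  lra.
(* The larger root of the quadratic equation for meeting the circle. *)
pose t := - (d * w) + Num.sqrt (d ^+ 2 * w ^+ 2 - d ^+ 2 + s).
have tE : t ^+ 2 + 2 * t * (d * w) = s - d ^+ 2.
  have := sqr_sqrtr D_ge0; rewrite /t.
  move: (Num.sqrt _) => z z2; ring: z2.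
exists t; apply: fc.
have -> : x + t * X - x0 = p + t * X by rewrite /p; ring.
have -> : y + t * Y - y0 = q + t * Y by rewrite /q; ring.
have -> : (p + t * X) ^+ 2 + (q + t * Y) ^+ 2 =
    d ^+ 2 + 2 * t * (p * X + q * Y) + t ^+ 2 * (X ^+ 2 + Y ^+ 2).
  by rewrite d2; ring.
by rewrite pX XY1 mulr1 -addrA (addrC (_ * _ * _)) tE addrC subrK.
Qed.

(** The circles of squared radius [(1 + e)^k r^2] get colour [c] in turn, and Bernoulli's inequality
    makes these radii unbounded. *)
Lemma circle_spreads (x0 y0 r : R) (c : C) : 0 < r ->
  (forall x y, (x - x0) ^+ 2 + (y - y0) ^+ 2 = r ^+ 2 -> f x y = c) ->
  forall x y, f x y = c.
Proof.
move=> r_gt0 fc x y; have [a [b [e [ab1 e_gt0 eAB]]]] := rotation_off_axis.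
have grow k : forall x y,
    (x - x0) ^+ 2 + (y - y0) ^+ 2 = (1 + e) ^+ k * r ^+ 2 -> f x y = c.
  elim: k => [|k IHk] x1 y1; first by rewrite mul1r => /fc.
  rewrite [_ ^+ k.+1]exprS -mulrA => xy; apply: (circle_growth ab1 e_gt0 eAB _ IHk).
    by rewrite mulr_ge0 ?exprn_ge0 ?addr_ge0// ltW.
  by rewrite xy.
set s := (x - x0) ^+ 2 + (y - y0) ^+ 2.
have [k sk] : exists k : nat, s <= (1 + e) ^+ k * r ^+ 2.
  have re_gt0 : 0 < r ^+ 2 * e by rewrite mulr_gt0 ?exprn_gt0.
  have bernoulli k : 1 + e *+ k <= (1 + e) ^+ k.
    elim: k => [|k IHk]; first by rewrite mulr0n addr0.
    rewrite exprS; apply: (le_trans _ (ler_wpM2l _ IHk)); last lra.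
    have : 0 <= e * e *+ k by rewrite mulrn_wge0 ?mulr_ge0// ltW.
    rewrite mulrS -mulrnAr; lra.
  have s_ge0 : 0 <= s by rewrite addr_ge0 ?sqr_ge0.
  have := archi_boundP (divr_ge0 s_ge0 (ltW re_gt0)).
  set k := Num.bound _; rewrite ltr_pdivrMr// => sk; exists k.
  apply: (le_trans (ltW sk)); rewrite mulrCA mulrC ler_wpM2r ?sqr_ge0//.
  by apply: le_trans (bernoulli k); rewrite mulr_natl ler_wpDl.
have rk_ge0 : 0 <= (1 + e) ^+ k * r ^+ 2.
  by rewrite mulr_ge0 ?exprn_ge0 ?addr_ge0// ltW.
apply: (circle_growth ab1 e_gt0 eAB rk_ge0 (grow k)); apply: (le_trans sk).
by rewrite ler_peMl// lerDl ltW.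
Qed.

End SmileFree.

(** * From coordinates back to pencils in the plane *)

Definition pt (R : realType) (x y : R) : plane R := \row_j (if j == 0 then x else y).

Lemma ptE (R : realType) (p : plane R) : p = pt (p 0 0) (p 0 1).
Proof.
apply/rowP => j; rewrite mxE; case: (unliftP 0 j) => [j' ->|->//].
by rewrite (ord1 j') /=; congr (p _ _); exact/val_inj.
Qed.

Lemma pencil_lines (R : realType) (n : nat) (O : plane R)
    (L : 'I_n -> set (plane R)) : is_pencil O L ->
  exists A B : 'I_n -> R, (forall i, A i ^+ 2 + B i ^+ 2 = 1) /\
    forall i t, L i (pt (O 0 0 + t * A i) (O 0 1 + t * B i)).
Proof.
move=> hL; have line i : exists w : R * R, w.1 ^+ 2 + w.2 ^+ 2 = 1 /\
    forall t, L i (pt (O 0 0 + t * w.1) (O 0 1 + t * w.2)).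
  have [[p [v [v0 ->]]] [t0 _ <-]] := hL i.
  pose N := Num.sqrt (v 0 0 ^+ 2 + v 0 1 ^+ 2).
  have N2 : N ^+ 2 = v 0 0 ^+ 2 + v 0 1 ^+ 2.
    by rewrite sqr_sqrtr// addr_ge0 ?sqr_ge0.
  have N0 : N != 0.
    apply: contra v0 => /eqP N0; move: N2; rewrite N0 expr0n => /esym/eqP.
    rewrite paddr_eq0 ?sqr_ge0// !sqrf_eq0 => /andP[/eqP v00 /eqP v01].
    by rewrite (ptE v) v00 v01; apply/eqP/rowP => j; rewrite !mxE; case: ifP.
  exists (v 0 0 / N, v 0 1 / N); split=> [|t] /=.
    by rewrite !expr_div_n -mulrDl -N2 divff// sqrf_eq0.
  exists (t0 + t / N) => //; rewrite [LHS]ptE !mxE.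
  by congr pt; field.
have [w wP] := choice line.
by exists (fst \o w), (snd \o w); split=> i; have [] := wP i.
Qed.

Lemma edistE (R : realType) (p q : plane R) :
  edist p q = Num.sqrt ((p 0 0 - q 0 0) ^+ 2 + (p 0 1 - q 0 1) ^+ 2).
Proof.
rewrite /edist !big_ord_recl big_ord0 addr0.
by rewrite (_ : lift ord0 ord0 = 1)//; exact/val_inj.
Qed.

Definition rotate (R : realType) (O P : plane R) (a b : R) (X : plane R) : plane R :=
  let x := X 0 0 - O 0 0 in let y := X 0 1 - O 0 1 in
  pt (P 0 0 + (a * x - b * y)) (P 0 1 + (a * y + b * x)).

Lemma rotate_isometry (R : realType) (O P : plane R) (a b : R) :
  a ^+ 2 + b ^+ 2 = 1 -> Defs.isometry (rotate O P a b).
Proof.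
move=> ab1 p q; rewrite !edistE !mxE /=; congr Num.sqrt.
rewrite -[RHS]mul1r -ab1; ring.
Qed.

(** Gallai's theorem asks for a finite type of colours, so the colours in use are numbered. *)
Lemma finite_colouring (T : Type) (C : Type) (f : T -> C) : finite_set (range f) ->
  exists (N : nat) (h : T -> 'I_N.+1), forall x y, h x = h y -> f x = f y.
Proof.
move=> /finite_setP[N /card_set_bijP[g [gN ginj _]]].
exists N, (fun x => inord (g (f x))) => x y hxy.
have gle z : (g (f z) < N.+1)%N by apply: ltnW; apply: gN; exists z.
apply: ginj; rewrite ?inE; [by exists x|by exists y|].
by have /(congr1 val) := hxy; rewrite /= !inordK.
Qed.

Theorem theorem1p3 (R : realType) (n : nat) (O : plane R)
    (L : 'I_n -> set (plane R)) (hL : is_pencil O L)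
    (C : Type) (f : plane R -> C)
    (finitely_many : finite_set (range f))
    (at_least_two : exists p q : plane R, f p <> f q) :
  exists (O' : plane R) (L' : 'I_n -> set (plane R)),
    congruent_copy O L O' L' /\ smiling f O' L'.
Proof.
apply: contrapT => no_smile.
have [A [B [AB1 LAB]]] := pencil_lines hL.
have smile_free x y a b c : a ^+ 2 + b ^+ 2 = 1 ->
    (forall i, exists t,
      f (pt (x + t * (a * A i - b * B i)) (y + t * (a * B i + b * A i))) = c) ->
    f (pt x y) = c.
  move=> ab1 hit; apply: contrapT => fc; apply: no_smile.
  pose g := rotate O (pt x y) a b.
  exists (g O), (fun i => g @` L i); split.
    by exists g => //; exact: rotate_isometry.
  exists c; split.
    move=> i; have [t ft] := hit i; eexists; last exact: ft.
    eexists; first exact: (LAB i t).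
    by rewrite /g /rotate !mxE /=; congr pt; ring.
  by rewrite (_ : g O = pt x y)// /g /rotate !mxE /= !subrr !mulr0 subr0 !addr0.
have [N [h hf]] := finite_colouring finitely_many.
(* The squares of the unit complex numbers [A i + i B i]. *)
pose z i := (A i ^+ 2 - B i ^+ 2, 2 * (A i * B i)).
have [[x0 y0] [m [m_gt0 zm]]] := gallai (codom z) (fun u => h (pt u.1 u.2)).
have mono : exists c, forall i,
    f (pt (x0 + m%:R * (A i ^+ 2 - B i ^+ 2)) (y0 + m%:R * (2 * (A i * B i)))) = c.
  have zE i : pt (x0 + m%:R * (z i).1) (y0 + m%:R * (z i).2) =
      pt ((x0, y0) + z i *+ m).1 ((x0, y0) + z i *+ m).2.
    by rewrite pairMnE /= !mulr_natl.
  (* Without lines the condition is empty and any colour serves. *)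
  have [i0 _|noI] := pickP 'I_n; last by exists (f 0) => i; have := noI i.
  exists (f (pt (x0 + m%:R * (z i0).1) (y0 + m%:R * (z i0).2))) => i.
  by apply: hf; rewrite !zE; apply: zm; exact: codom_f.
have [c fc] := mono.
have mR : 0 < m%:R :> R by rewrite ltr0n.
have fE : forall x y, f (pt x y) = c.
  apply: (circle_spreads AB1 smile_free mR).
  exact: (circle_monochromatic AB1 smile_free mR).
by have [p [q]] := at_least_two; rewrite (ptE p) (ptE q) !fE.
Qed.
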